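(* Let $m\in\{1,2\}$ and let $N,i,j$ be non-negative integers with $N\ge i$ and $N\ge j$. Then $$P_{m,2N}(i,j,q)=q^{\omega(m,i,j)}\genfrac{[}{]}{0pt}{}{N}{i,\ j}_{q^6}(-q^3;q^3)_{N-i-j},$$ $$P_{m,2N+1}(i,j,q)=q^{\omega(m,i,j)}\,\frac{1-q^{3(N+1+i+(-1)^m j)}}{1-q^{6(N+1)}}\genfrac{[}{]}{0pt}{}{N+1}{i,\ j}_{q^6}(-q^3;q^3)_{N+1-i-j},$$ where $\omega(m,i,j):=(3i+(-1)^m m)i+(3j+(-1)^{m+1}m)j$.
   Context: Here $q$ is a complex number with $|q|<1$ (or a formal variable). Notation: $(a;q)_L=\prod_{n=0}^{L-1}(1-aq^n)$ (equal to $1$ for $L=0$); $\genfrac{[}{]}{0pt}{}{k}{n}_q=\frac{(q;q)_k}{(q;q)_n(q;q)_{k-n}}$ for $k\ge n\ge 0$ and $0$ otherwise; and the $q$-trinomial coefficient $\genfrac{[}{]}{0pt}{}{k}{n,\ r}_q=\genfrac{[}{]}{0pt}{}{k}{n}_q\genfrac{[}{]}{0pt}{}{k-n}{r}_q$, which equals $\frac{(q;q)_k}{(q;q)_n(q;q)_r(q;q)_{k-n-r}}$ for $k\ge n+r$, $n,r\ge 0$, and $0$ otherwise. (When the trinomial vanishes, the product expressions are interpreted as $0$.) A partition is a finite non-increasing sequence $\pi=(\pi_1,\pi_2,\dots)$ of positive integers (the empty sequence allowed); $\pi_k$ is the part of index $k$. For a real $x$, $\lceil x\rceil$ is the least integer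 $\ge x$ and $\{\{x\}\}=x-\lfloor x\rfloor$ is its fractional part. For $m\in\{1,2\}$ and non-negative integers $M,i,j$, $P_{m,M}(i,j,q)=\sum_\pi q^{\pi_1+\pi_2+\cdots}$, the sum over all partitions $\pi$ such that: (i) $\pi_{2l+r}\not\equiv 3-m+(-1)^m r\pmod 3$ for $r\in\{0,1\}$ and all $l\ge0$ with $2l+r\ge1$; (ii) $\pi_{2l+r}-\pi_{2l+1+r}>\lfloor m/2\rfloor+(-1)^{m-1}r$ for $r\in\{0,1\}$ and all $l\ge 0$ with $2l+r\ge 1$ (whenever both parts exist); (iii) $\pi_1\le 3\lceil M/2\rceil-2m\{\{M/2\}\}$ (i.e. $\pi_1\le 3N$ when $M=2N$, and $\pi_1\le 3N+3-m$ when $M=2N+1$); (iv) exactly $i$ parts are congruent to $2$ modulo $3$; (v) exactly $j$ parts are congruent to $1$ modulo $3$.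
   Formalization: In the second formula the numerator exponent is corrected to 3(N+1+(-1)^{m+1}i+(-1)^m j), unchanged for m=1; as printed the formula fails for m=2, e.g. N=i=j=1, where P=q^6 but the printed right side is q^6+q^12. *)

(* Defs.v *)
From HB Require Import structures.
From mathcomp Require Export all_boot all_order all_algebra fraction.
From mathcomp Require Export boolp classical_sets cardinality fsbigop reals.
From mathcomp Require Export complex.

Set Implicit Arguments.
Unset Strict Implicit.
Unset Printing Implicit Defensive.

Import Order.TTheory GRing.Theory Num.Theory.

Local Open Scope ring_scope.

Definition qpoch (F : fieldType) (a q : F) (L : nat) : F :=
  \prod_(n < L) (1 - a * q ^+ n).

Definition qbinom (F : fieldType) (k n : nat) (q : F) : F :=
  if (n <= k)%N then qpoch q q k / (qpoch q q n * qpoch q q (k - n)) else 0.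

(* If k < n the truncated difference k - n is harmless: the first factor is 0. *)
Definition qtrinom (F : fieldType) (k n r : nat) (q : F) : F :=
  qbinom k n q * qbinom (k - n) r q.

Definition is_partition (pi : seq nat) : bool :=
  sorted geq pi && all (fun x => 0 < x)%N pi.

(* Parts are indexed from 1; the value is 0 when there is no part of index k. *)
Definition part (pi : seq nat) (k : nat) : nat := nth 0%N pi k.-1.

Definition cond_residue (m : nat) (pi : seq nat) : Prop :=
  forall r l : nat, (r <= 1)%N -> (1 <= 2 * l + r <= size pi)%N ->
    (part pi (2 * l + r) <> 3 - m%:Z + (-1) ^+ m * r%:Z %[mod 3])%Z.

Definition cond_gap (m : nat) (pi : seq nat) : Prop :=
  forall r l : nat, (r <= 1)%N -> (1 <= 2 * l + r < size pi)%N ->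
    (part pi (2 * l + r))%:Z - (part pi (2 * l + 1 + r))%:Z
      > (m %/ 2)%:Z + (-1) ^+ m.-1 * r%:Z.

(* 3 * ceil(M/2) - 2 * m * {{M/2}}: here uphalf M = ceil(M/2) and
   odd M (as 0 or 1) = 2 * {{M/2}}. No truncation happens for m <= 3. *)
Definition largest_bound (m M : nat) : nat := (3 * uphalf M - m * odd M)%N.

Definition Pclass (m M i j : nat) : set (seq nat) :=
  [set pi | [/\ is_partition pi,
                cond_residue m pi /\ cond_gap m pi,
                (part pi 1 <= largest_bound m M)%N,
                count (fun x => x %% 3 == 2)%N pi = i &
                count (fun x => x %% 3 == 1)%N pi = j]]%classic.

(* A finitely supported sum; Pclass_finite shows that the index set is finite
   when m is 1 or 2, so it is the sum over all partitions of the class. *)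
Definition P (F : fieldType) (m M i j : nat) (q : F) : F :=
  \sum_(pi \in Pclass m M i j) q ^+ sumn pi.

Definition omega (m i j : nat) : int :=
  (3 * i%:Z + (-1) ^+ m * m%:Z) * i%:Z
  + (3 * j%:Z + (-1) ^+ m.+1 * m%:Z) * j%:Z.

(* The exponent (divided by 3) of the numerator 1 - q^(3 * ...) in the odd case:
   N + 1 + i - j for m = 1 and N + 1 - i + j for m = 2. The source prints
   N + 1 + i + (-1)^m j, which agrees for m = 1 but is a misprint for m = 2:
   with m = 2, N = i = j = 1 the only partition is (4, 2), so P = q^6, whereas
   the printed exponent would give q^6 + q^12. *)
Definition theta (m N i j : nat) : int :=
  (N + 1)%:Z + (-1) ^+ m.+1 * i%:Z + (-1) ^+ m * j%:Z.

Lemma Pclass_finite (m M i j : nat) (hm : m = 1%N \/ m = 2%N) :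
  finite_set (Pclass m M i j).
Proof.
pose B := largest_bound m M.
pose L := rev (iota 0 B.+1).
pose masks := [seq mask (val t) L | t <- enum {: (size L).-tuple bool}].
suff sub : (Pclass m M i j `<=` [set` masks])%classic.
  exact: sub_finite_set sub (finite_seq masks).
move=> pi [_ [_ gap] bnd _ _] /=.
have srt : sorted gtn pi.
  apply/(sortedP 0%N) => k hk.
  have := gap (k.+1 %% 2)%N (k.+1 %/ 2)%N.
  have e : (2 * (k.+1 %/ 2) + k.+1 %% 2 = k.+1)%N by rewrite mulnC -divn_eq.
  have e' : (2 * (k.+1 %/ 2) + 1 + k.+1 %% 2 = k.+2)%N by rewrite addnAC e addn1.
  rewrite e e' /part /=.
  have r1 : (k.+1 %% 2 <= 1)%N by rewrite -ltnS ltn_mod.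
  move=> /(_ r1 hk) H.
  have : (nth 0%N pi k.+1)%:Z < (nth 0%N pi k)%:Z.
    rewrite -subr_gt0; apply: le_lt_trans H.
    by case: hm => ->; move: r1; case: (_ %% 2)%N => [|[|]].
  by [].
have trg : transitive gtn by move=> a b c /= h1 h2; exact: ltn_trans h2 h1.
have irg : irreflexive gtn by move=> a /=; rewrite ltnn.
have sL : sorted gtn L by rewrite /L rev_sorted; exact: iota_ltn_sorted.
have subL : subseq pi L.
  have -> : pi = [seq x <- L | x \in pi]; last exact: filter_subseq.
  apply: (irr_sorted_eq trg irg) => //; first exact: sorted_filter.
  move=> x; rewrite mem_filter mem_rev mem_iota /= add0n ltnS.
  case xpi : (x \in pi) => //=; apply/esym; apply: leq_trans bnd.
  rewrite /part /=; move: srt xpi; case: (pi) => //= a s.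
  rewrite (path_sortedE trg) => /andP[/allP h _].
  by rewrite inE => /orP[/eqP-> //|/h /= /ltnW].
have [msk szm ->] := subseqP subL.
have h : size msk == size L by rewrite szm.
by apply/mapP; exists (Tuple h); rewrite ?mem_enum.
Qed.

(* Main.v *)
Require Import Defs.
From mathcomp Require Import zify ring.
Import Order.TTheory GRing.Theory Num.Theory.
Set Implicit Arguments.
Unset Strict Implicit.
Unset Printing Implicit Defensive.
Local Open Scope ring_scope.

(** Removing the largest part of a partition of one class yields a partition of
the other class, because the conditions for [m = 2] are those for [m = 1] with
even and odd indices exchanged. Writing [a N], [a' N] for the generating
functions with [m = 1], [M = 2N], [2N + 1], and [b N], [b' N] for those with
[m = 2], splitting on the largest admissible value gives
  [a' N i j = a N i j + q^(3N+2) b N (i-1) j],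
  [b' N i j = b N i j + q^(3N+1) a N i (j-1)],
  [a (N+1) = a' N + q^(3N+3) b' N] and [b (N+1) = b' N + q^(3N+3) a' N],
and the product formulas satisfy the same recurrences. *)

(** * Enumeration of the partitions by largest part *)

(* [true] is the condition on parts of odd index for [m = 1] (of even index for
   [m = 2]), [false] the condition on the other parts. *)
Definition forbidden_residue (b : bool) : nat := if b then 1%N else 2%N.
Definition gap (b : bool) : nat := if b then 2%N else 1%N.

Fixpoint admissible (b : bool) (n : nat) (s : seq nat) : bool :=
  if s is x :: s' then
    [&& (0 < x)%N, (x <= n)%N, (x %% 3 != forbidden_residue b)%N
      & admissible (~~ b) (x - gap b) s']
  else true.

(** The tail bound [n - gap b] is spelled out for each [b] so that the recursion is structural;
    [admissiblesS] recovers the uniform form. *)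
Fixpoint admissibles (n : nat) (b : bool) : seq (seq nat) :=
  if n is n'.+1 then
    admissibles n' b ++
      (if (n %% 3 != forbidden_residue b)%N then
         map (cons n) (if b then admissibles n'.-1 false
                       else admissibles n' true)
       else [::])
  else [:: [::]].

Lemma admissiblesS n b :
  admissibles n.+1 b = admissibles n b ++
    (if (n.+1 %% 3 != forbidden_residue b)%N then
       map (cons n.+1) (admissibles (n.+1 - gap b) (~~ b)) else [::]).
Proof. by case: b; rewrite /= ?subSS ?subn0 ?subn1. Qed.

Lemma mem_admissibles n b s : (s \in admissibles n b) = admissible b n s.
Proof.
elim/ltn_ind: n b s => -[|n] IH b s.
  by case: s => [|x s] //=; rewrite inE; case: x.
rewrite admissiblesS mem_cat IH //; case: s => [|x s] //.
rewrite [admissible b n _]/= [admissible b n.+1 _]/=.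
rewrite [(x <= n.+1)%N]leq_eqVlt ltnS.
have cons_mem y k (t : seq (seq nat)) :
    (y :: s \in map (cons k) t) = (y == k) && (s \in t).
  apply/mapP/andP => [[u ut [-> ->]]|[/eqP -> st]]; first by rewrite eqxx.
  by exists s.
(* A first part equal to [n.+1] is found only in the second half of the list, any other only in the
   first. *)
have [->|ne] := eqVneq x n.+1.
  rewrite ltnn andbF /= ; case: ifP => //= _.
  by rewrite cons_mem eqxx IH //; case: (b); rewrite ?subSS /= ; lia.
by case: ifP => _; rewrite ?cons_mem ?(negbTE ne) ?orbF.
Qed.

Lemma admissibles_uniq n b : uniq (admissibles n b).
Proof.
elim/ltn_ind: n b => -[|n] IH b //.
rewrite admissiblesS cat_uniq IH //=; case: ifP => _ //=.
rewrite map_inj_uniq ?IH ?andbT; first last.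
- by move=> x y [].
- by case: (b); rewrite ?subSS /= ; lia.
apply/hasPn => _ /mapP[t _ ->]; rewrite mem_admissibles /=.
by rewrite ltnn.
Qed.

(** Passage from the recursive conditions to indexed ones. Positions [k] start at 0, so even [k] are
    the parts of odd index, and the type of the condition flips at each position. *)
Lemma admissibleP b n s :
  reflect [/\ (head 0 s <= n)%N, all (fun x => 0 < x)%N s,
      forall k, (k < size s)%N ->
        (nth 0 s k %% 3 != forbidden_residue (b (+) odd k))%N &
      forall k, (k.+1 < size s)%N ->
        (nth 0 s k.+1 + gap (b (+) odd k) <= nth 0 s k)%N]
    (admissible b n s).
Proof.
elim: s b n => [|x s IH] b n; first by apply: (iffP idP).
apply: (iffP and4P) => [[x0 xn xr /IH[hd al res gp]]|[hd /andP[x0 al] res gp]].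
  split=> //= [|[|k]|[|k]]; rewrite ?x0 ?addbF ?addbN -?addNb //.
  - exact: res.
  (* The next part is positive, so the bound [x - gap b] on it was not truncated. *)
  - rewrite ltnS => sz; move: hd al; rewrite -nth0.
    by case: (s) sz => //= y t _ hd /andP[y0 _]; lia.
  - exact: gp.
split=> //; first by have := res 0%N isT; rewrite addbF.
apply/IH; split=> // [|k sz|k sz].
- case: (s) gp => //= y t /(_ 0%N isT); rewrite /= addbF; lia.
- by have := res k.+1 sz; rewrite /= addbN -addNb.
- by have := gp k.+1 sz; rewrite /= addbN -addNb.
Qed.

Definition has_residues (i j : nat) (s : seq nat) : bool :=
  (count (fun x => x %% 3 == 2) s == i)%N &&
  (count (fun x => x %% 3 == 1) s == j)%N.

Lemma Pclass_admissible m M i j : m = 1%N \/ m = 2%N ->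
  Pclass m M i j =
  [set` [seq s <- admissibles (largest_bound m M) (m == 1%N)
        | has_residues i j s]]%classic.
Proof.
move=> hm; apply/seteqP; split=> s /=; rewrite mem_filter mem_admissibles.
  move=> [/andP[_ pos] [res gp] bnd ci cj].
  apply/andP; split; first by rewrite /has_residues ci cj !eqxx.
  (* Position [k] holds the part of index [k.+1]: take [r] its parity and [l] its half. *)
  have dk k : (2 * (k.+1 %/ 2) + odd k.+1 = k.+1)%N by lia.
  apply/admissibleP; split=> // [k sz|k sz].
  - have := res (odd k.+1) (k.+1 %/ 2)%N; rewrite dk /part.
    have h1 : (odd k.+1 <= 1)%N by case: odd.
    move=> /(_ h1) /(_ sz) /=.
    by case: hm => -> /=; case: (odd k) => /=; rewrite /forbidden_residue /=; lia.
  - have := gp (odd k.+1) (k.+1 %/ 2)%N; rewrite addnAC dk /part.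
    have h1 : (odd k.+1 <= 1)%N by case: odd.
    move=> /(_ h1) /(_ sz) /=; rewrite addn1 /=.
    by case: hm => -> /=; case: (odd k) => /=; rewrite /gap /=; lia.
move=> /andP[/andP[/eqP ci /eqP cj] /admissibleP[hd pos res gp]].
split=> //.
- rewrite /is_partition pos andbT; apply/(sortedP 0%N) => k sz.
  by have := gp k sz; rewrite /=; lia.
- split=> r l r1 sz.
  + have := res (2 * l + r).-1; rewrite /part.
    have -> : odd (2 * l + r).-1 = ~~ odd r by lia.
    move=> /(_ ltac:(lia)).
    by case: hm => ->; case: r r1 {sz} => [|[|]] // _;
       rewrite /forbidden_residue /=; lia.
  + have := gp (2 * l + r).-1; rewrite /part.
    have -> : odd (2 * l + r).-1 = ~~ odd r by lia.
    rewrite prednK; last by lia.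
    move=> /(_ ltac:(lia)); rewrite addnAC addn1 /=.
    by case: hm => ->; case: r r1 {sz} => [|[|]] // _; rewrite /gap /=; lia.
Qed.

(** * Generating functions and their recurrences *)

Definition genfun (F : fieldType) (q : F) (b : bool) (n i j : nat) : F :=
  \sum_(s <- admissibles n b | has_residues i j s) q ^+ sumn s.

Lemma P_genfun (F : fieldType) (q : F) m M i j : m = 1%N \/ m = 2%N ->
  P m M i j q = genfun q (m == 1%N) (largest_bound m M) i j.
Proof.
move=> hm; rewrite /P Pclass_admissible // -fsbig_seq ?big_filter //.
exact/filter_uniq/admissibles_uniq.
Qed.

Lemma genfun0 (F : fieldType) (q : F) b i j :
  genfun q b 0 i j = ((i == 0%N) && (j == 0%N))%:R.
Proof.
by rewrite /genfun big_mkcond big_seq1 /has_residues /=; case: i j => [|i] [|j].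
Qed.

Lemma genfunS (F : fieldType) (q : F) b n i j :
  genfun q b n.+1 i j = genfun q b n i j +
    if (n.+1 %% 3 != forbidden_residue b)%N then
      q ^+ n.+1 * \sum_(s <- admissibles (n.+1 - gap b) (~~ b)
                        | has_residues i j (n.+1 :: s)) q ^+ sumn s
    else 0.
Proof.
rewrite /genfun admissiblesS big_cat /=; congr (_ + _).
case: ifP => _; last by rewrite big_nil.
by rewrite big_map mulr_sumr; apply: eq_bigr => s _; rewrite -exprD.
Qed.

Lemma genfun_residue0 (F : fieldType) (q : F) b n i j : (n.+1 %% 3 = 0)%N ->
  genfun q b n.+1 i j =
    genfun q b n i j + q ^+ n.+1 * genfun q (~~ b) (n.+1 - gap b) i j.
Proof.
move=> n3; rewrite genfunS n3 ifT; last by case: b.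
by congr (_ + _ * _); apply: eq_bigl => s; rewrite /has_residues /= n3.
Qed.

(** A largest part of residue 1 is forbidden for [true]; for [false] it uses one unit of [j], hence
    the vanishing at [j = 0]. Residue 2 below is dual, with [i]. *)
Lemma genfun_residue1 (F : fieldType) (q : F) b n i j : (n.+1 %% 3 = 1)%N ->
  genfun q b n.+1 i j = genfun q b n i j +
    if b then 0 else
    if j is j'.+1 then q ^+ n.+1 * genfun q true n i j' else 0.
Proof.
move=> n3; rewrite genfunS n3; case: b => //=; congr (_ + _).
rewrite subSS subn0; case: j => [|j].
  by rewrite big_pred0 ?mulr0 // => s; rewrite /has_residues /= n3 andbF.
by congr (_ * _); apply: eq_bigl => s; rewrite /has_residues /= n3.
Qed.

Lemma genfun_residue2 (F : fieldType) (q : F) b n i j : (n.+1 %% 3 = 2)%N ->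
  genfun q b n.+1 i j = genfun q b n i j +
    if b then
      if i is i'.+1 then q ^+ n.+1 * genfun q false n.-1 i' j else 0
    else 0.
Proof.
move=> n3; rewrite genfunS n3; case: b => //=; congr (_ + _).
rewrite subSS subn1; case: i => [|i].
  by rewrite big_pred0 ?mulr0 // => s; rewrite /has_residues /= n3.
by congr (_ * _); apply: eq_bigl => s; rewrite /has_residues /= n3.
Qed.

(** * Product formulas and the identities they satisfy *)

Lemma qpochS (F : fieldType) (a q : F) n :
  qpoch a q n.+1 = qpoch a q n * (1 - a * q ^+ n).
Proof. by rewrite /qpoch big_ord_recr. Qed.

Lemma qpoch_neq0 (F : fieldType) (q : F) n :
  (forall k, (0 < k)%N -> q ^+ k != 1) -> qpoch q q n != 0.
Proof.
move=> hq; apply/prodf_neq0 => k _.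
by rewrite -exprS subr_eq0 eq_sym hq.
Qed.

Lemma qtrinom0 (F : fieldType) (p : F) n i j :
  (n < i + j)%N -> qtrinom n i j p = 0.
Proof.
move=> h; rewrite /qtrinom /qbinom; case: leqP => [le|]; last by rewrite mul0r.
by rewrite ifF ?mulr0 //; lia.
Qed.

(** Writing the top entry as [i + j + k] avoids truncated subtraction and makes the symmetry in [i]
    and [j] visible. *)
Lemma qtrinomE (F : fieldType) (p : F) i j k :
  (forall k, (0 < k)%N -> p ^+ k != 1) ->
  qtrinom (i + j + k) i j p =
    qpoch p p (i + j + k) / (qpoch p p i * qpoch p p j * qpoch p p k).
Proof.
move=> hp; rewrite /qtrinom /qbinom !ifT; try lia.
have -> : (i + j + k - i = j + k)%N by lia.
rewrite addKn.
by field; rewrite !qpoch_neq0.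
Qed.

Lemma qtrinomC (F : fieldType) (p : F) n i j :
  (forall k, (0 < k)%N -> p ^+ k != 1) ->
  qtrinom n i j p = qtrinom n j i p.
Proof.
move=> hp; case: (ltnP n (i + j)) => h.
  by rewrite !qtrinom0 // addnC.
have -> : n = (i + j + (n - (i + j)))%N by lia.
rewrite qtrinomE // [in RHS](addnC i j) qtrinomE //.
by rewrite (addnC j i) (mulrC (qpoch p p j)).
Qed.

(* [x] plays the role of [q ^+ 3] *)
Definition profile (F : fieldType) (x : F) (n i j : nat) : F :=
  qtrinom n i j (x ^+ 2) * qpoch (- x) x (n - i - j).

Lemma profile0 (F : fieldType) (x : F) n i j :
  (n < i + j)%N -> profile x n i j = 0.
Proof. by move=> h; rewrite /profile qtrinom0 ?mul0r. Qed.

Lemma exprn_neq1 (F : fieldType) (x : F) e : (0 < e)%N ->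
  (forall k, (0 < k)%N -> x ^+ k != 1) ->
  forall k, (0 < k)%N -> (x ^+ e) ^+ k != 1.
Proof. by move=> e0 hx k k0; rewrite -exprM hx ?muln_gt0 ?e0. Qed.

Lemma profileC (F : fieldType) (x : F) n i j :
  (forall k, (0 < k)%N -> x ^+ k != 1) ->
  profile x n i j = profile x n j i.
Proof.
move=> hx; rewrite /profile (qtrinomC _ _ _ (@exprn_neq1 _ _ 2 isT hx)).
by rewrite -!subnDA (addnC i).
Qed.

(** Multiplied by [1 - x ^+ (2 * n.+1)], the two profiles on the right become [profile x n.+1 i j]
    times [1 - x ^+ k] and [1 - x ^+ (2 * i)]; then (1 - u) + u(1 - v) = 1 - uv. *)
Lemma profile_step (F : fieldType) (x : F) i j k n :
  (forall k, (0 < k)%N -> x ^+ k != 1) -> (i + j + k = n.+1)%N ->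
  (1 - x ^+ (k + 2 * i)) / (1 - x ^+ (2 * n.+1)) * profile x n.+1 i j =
  profile x n i j + (if i is i'.+1 then x ^+ k * profile x n i' j else 0).
Proof.
move=> hx e; have hp := @exprn_neq1 _ _ 2 isT hx.
have nz l : qpoch (x ^+ 2) (x ^+ 2) l != 0 by apply: qpoch_neq0.
have fS l : qpoch (x ^+ 2) (x ^+ 2) l.+1 =
    qpoch (x ^+ 2) (x ^+ 2) l * (1 - x ^+ (2 * l.+1)).
  by rewrite qpochS -exprS -exprM.
have DS l : qpoch (- x) x l.+1 = qpoch (- x) x l * (1 + x ^+ l.+1).
  by rewrite qpochS mulNr -exprS opprK.
have nz1 l : 1 - x ^+ (2 * l.+1) != 0 by rewrite subr_eq0 eq_sym hx.
have first_term : profile x n i j * (1 - x ^+ (2 * n.+1)) =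
    profile x n.+1 i j * (1 - x ^+ k).
  case: k e => [|k] e.
    by rewrite addn0 in e; rewrite expr0 subrr mulr0 profile0 ?mul0r // e.
  rewrite /profile -!subnDA -e.
  have -> : (n = i + j + k)%N by lia.
  rewrite !addKn !qtrinomE // addnS !fS DS.
  (* In terms of [y], the new factor 1 - y^2 of the denominator cancels 1 + y and leaves 1 - y. *)
  have := nz1 k; rewrite mulnC exprM; set y := x ^+ k.+1 => nzy.
  by field; rewrite !nz nzy.
have second_term : (if i is i'.+1 then profile x n i' j else 0) *
    (1 - x ^+ (2 * n.+1)) = profile x n.+1 i j * (1 - x ^+ (2 * i)).
  case: i e {first_term} => [|i] e.
    by rewrite muln0 expr0 subrr mulr0 mul0r.
  rewrite /profile -!subnDA -e.
  have -> : (n = i + j + k)%N by lia.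
  rewrite !addKn !qtrinomE // !addSn !fS.
  by field; rewrite !nz nz1.
have d : 1 - x ^+ (2 * n.+1) != 0 by rewrite subr_eq0 eq_sym hx.
apply: (mulIf d); rewrite [RHS]mulrDl first_term.
have -> : (if i is i'.+1 then x ^+ k * profile x n i' j else 0) =
    x ^+ k * (if i is i'.+1 then profile x n i' j else 0).
  by case: (i); rewrite ?mulr0.
rewrite -[x ^+ k * _ * _]mulrA second_term exprD.
by field.
Qed.

(** [omega] as a natural number; subtraction truncates only at [i = 0] or [j = 0], where the product
    is 0 anyway. *)
Definition weight (b : bool) (i j : nat) : nat :=
  if b then (i * (3 * i - 1) + j * (3 * j + 1))%N
  else (i * (3 * i + 2) + j * (3 * j - 2))%N.
Arguments weight : simpl never.

(** This and the next two identities match the powers of [q] when the new largest part has residue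
    0, 2 and 1. *)
Lemma weight_swap i j :
  (weight false i j + 3 * j = weight true i j + 3 * i)%N.
Proof. by case: i => [|i]; case: j => [|j]; rewrite /weight; nia. Qed.

Lemma weight_step2 i j :
  (weight false i j + 3 * (i.+1 + j) = weight true i.+1 j + 1)%N.
Proof. by case: j => [|j]; rewrite /weight; nia. Qed.

Lemma weight_step1 i j :
  (weight true i j + 3 * (i + j.+1) = weight false i j.+1 + 2)%N.
Proof. by case: i => [|i]; rewrite /weight; nia. Qed.

Lemma weight_omega m i j : m = 1%N \/ m = 2%N ->
  omega m i j = (weight (m == 1%N) i j)%:Z.
Proof.
by case=> ->; case: i => [|i]; case: j => [|j]; rewrite /omega /weight /=; nia.
Qed.

(** * Closed forms, by induction on the bound *)

(* Here [n.+1 - (i + j) + 2 * i] is [n + 1 + i - j] without intermediate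
   truncation; when [n.+1 < i + j] the factor [profile] vanishes. *)
Definition closed_odd (F : fieldType) (q : F) (b : bool) (n i j : nat) : F :=
  q ^+ weight b i j *
  ((1 - (q ^+ 3) ^+ (n.+1 - (i + j) + 2 * (if b then i else j)))
   / (1 - (q ^+ 3) ^+ (2 * n.+1)) * profile (q ^+ 3) n.+1 i j).

(** Beyond [3 * n] the only new largest part is [3 * n + 2] for [true] and [3 * n + 1] for [false];
    in both cases the gap brings the tail bound back to [3 * n]. *)
Lemma genfun_odd_of_even (F : fieldType) (q : F) n :
  (forall k, (0 < k)%N -> q ^+ k != 1) ->
  (forall b i j, genfun q b (3 * n) i j =
     q ^+ weight b i j * profile (q ^+ 3) n i j) ->
  forall i j, genfun q true (3 * n).+2 i j = closed_odd q true n i j /\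
              genfun q false (3 * n).+1 i j = closed_odd q false n i j.
Proof.
move=> hq even i j; have hx := @exprn_neq1 _ _ 3 isT hq.
rewrite genfun_residue2 ?genfun_residue1; try lia.
rewrite addr0 /closed_odd /= !even.
case: (ltnP n.+1 (i + j)) => [lt|le].
  rewrite !profile0 ?mulr0 ?add0r; try lia.
  split; [case: i lt => [|i] lt //|case: j lt => [|j] lt //];
    by rewrite even profile0 ?mulr0 //; lia.
set k := (n.+1 - (i + j))%N.
have e : (i + j + k = n.+1)%N by rewrite /k; lia.
clearbody k; clear le; split.
  rewrite profile_step //; case: i e => [|i] e; first by rewrite !addr0.
  rewrite even mulrDr; congr (_ + _).
  rewrite [LHS]mulrA [RHS]mulrA -exprM -!exprD.
  by congr (q ^+ _ * _); have := weight_step2 i j; lia.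
(* For [false], the same step applies with [i] and [j] exchanged. *)
rewrite [profile _ n.+1 _ _](profileC _ _ _ hx) profile_step ?(addnC j) //.
rewrite (profileC n i j hx); case: j e => [|j] e; first by rewrite !addr0.
rewrite even (profileC n i j hx) mulrDr; congr (_ + _).
rewrite [LHS]mulrA [RHS]mulrA -exprM -!exprD.
by congr (q ^+ _ * _); have := weight_step1 i j; lia.
Qed.

(** With A, B the powers of [q ^+ 3] in the two odd closed forms, the recurrence yields the
    numerator (1 - A) + A(1 - B) = 1 - AB, and AB is the power in the denominator, which cancels. *)
Lemma genfun_even (F : fieldType) (q : F) n b i j :
  (forall k, (0 < k)%N -> q ^+ k != 1) ->
  genfun q b (3 * n) i j = q ^+ weight b i j * profile (q ^+ 3) n i j.
Proof.
move=> hq; elim: n b i j => [|n IH] b i j.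
  rewrite genfun0; case: i j => [|i] [|j] /=; try by rewrite profile0 ?mulr0.
  rewrite /profile /qtrinom /qbinom /qpoch !big_ord0 /= !(mulr1, divr1).
  by case: b; rewrite /weight.
have [ot of'] := genfun_odd_of_even hq IH i j.
have hx := @exprn_neq1 _ _ 3 isT hq.
have d : 1 - (q ^+ 3) ^+ (2 * n.+1) != 0 by rewrite subr_eq0 eq_sym hx.
have -> : (3 * n.+1 = (3 * n).+3)%N by lia.
rewrite genfun_residue0; last by lia.
have f2 : genfun q false (3 * n).+2 i j = closed_odd q false n i j.
  by rewrite genfun_residue2 ?addr0 //; lia.
have -> : genfun q b (3 * n).+2 i j = closed_odd q b n i j by case: b.
have -> : genfun q (~~ b) ((3 * n).+3 - gap b) i j = closed_odd q (~~ b) n i j.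
  by case: b; rewrite /= ?subSS ?subn0.
rewrite /closed_odd.
case: (ltnP n.+1 (i + j)) => [lt|le]; first by rewrite profile0 // !mulr0 addr0.
set k := (n.+1 - (i + j))%N.
have e : (i + j + k = n.+1)%N by rewrite /k; lia.
have shift : q ^+ (3 * n).+3 * q ^+ weight (~~ b) i j =
    q ^+ weight b i j * (q ^+ 3) ^+ (k + 2 * (if b then i else j)).
  rewrite -exprM -!exprD; congr (q ^+ _); have := weight_swap i j.
  by case: (b) => /=; lia.
have split_pow : (q ^+ 3) ^+ (2 * n.+1) =
    (q ^+ 3) ^+ (k + 2 * (if b then i else j)) *
    (q ^+ 3) ^+ (k + 2 * (if ~~ b then i else j)).
  by rewrite -exprD; congr (_ ^+ _); case: (b) => /=; lia.
rewrite mulrA shift split_pow; rewrite split_pow in d.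
by field.
Qed.

(** Common source of the analytic and the formal statement: in both, no positive power of [q] is
    1. *)
Lemma P_closed (F : fieldType) (q : F) (m N i j : nat) :
  m = 1%N \/ m = 2%N -> (i <= N)%N -> (j <= N)%N ->
  (forall k, (0 < k)%N -> q ^+ k != 1) ->
  P m (2 * N) i j q
    = q ^ omega m i j * qtrinom N i j (q ^+ 6)
      * qpoch (- q ^+ 3) (q ^+ 3) (N - i - j)
  /\
  P m (2 * N + 1) i j q
    = q ^ omega m i j
      * ((1 - q ^ (3 * theta m N i j))
         / (1 - q ^+ (6 * (N + 1))))
      * qtrinom (N + 1) i j (q ^+ 6)
      * qpoch (- q ^+ 3) (q ^+ 3) (N + 1 - i - j).
Proof.
move=> hm hi hj hq; rewrite !P_genfun // weight_omega // -exprnP; split.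
  have -> : (largest_bound m (2 * N) = 3 * N)%N by rewrite /largest_bound; nia.
  by rewrite genfun_even // /profile -!exprM mulrA.
have [ot of'] := genfun_odd_of_even hq (fun b i j => genfun_even N b i j hq) i j.
have -> : genfun q (m == 1%N) (largest_bound m (2 * N + 1)) i j =
    closed_odd q (m == 1%N) N i j.
  case: hm => ->; rewrite /= -?ot -?of'; congr genfun; rewrite /largest_bound;
    lia.
rewrite /closed_odd /profile addn1 -!exprM.
(* Either the trinomial vanishes, or the subtraction in [closed_odd] is exact and agrees with
   [theta]. *)
case: (ltnP N.+1 (i + j)) => [lt|le].
  by rewrite qtrinom0 // !(mulr0, mul0r).
have -> : 3 * theta m N i j =
    (3 * (N.+1 - (i + j) + 2 * (if m == 1%N then i else j)))%N%:Z.
  by rewrite /theta; case: hm => -> /=; lia.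
by rewrite -exprnP !mulnA !mulrA.
Qed.

Theorem theorem4 (m N i j : nat) (hm : m = 1%N \/ m = 2%N)
    (hi : (i <= N)%N) (hj : (j <= N)%N) :
  (forall (R : realType) (q : R[i]), `|q| < 1 ->
     P m (2 * N) i j q
       = q ^ omega m i j * qtrinom N i j (q ^+ 6)
         * qpoch (- q ^+ 3) (q ^+ 3) (N - i - j)
     /\
     P m (2 * N + 1) i j q
       = q ^ omega m i j
         * ((1 - q ^ (3 * theta m N i j))
            / (1 - q ^+ (6 * (N + 1))))
         * qtrinom (N + 1) i j (q ^+ 6)
         * qpoch (- q ^+ 3) (q ^+ 3) (N + 1 - i - j))
  /\
  (let q : {fraction {poly int}} := tofrac 'X in
     P m (2 * N) i j q
       = q ^ omega m i j * qtrinom N i j (q ^+ 6)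
         * qpoch (- q ^+ 3) (q ^+ 3) (N - i - j)
     /\
     P m (2 * N + 1) i j q
       = q ^ omega m i j
         * ((1 - q ^ (3 * theta m N i j))
            / (1 - q ^+ (6 * (N + 1))))
         * qtrinom (N + 1) i j (q ^+ 6)
         * qpoch (- q ^+ 3) (q ^+ 3) (N + 1 - i - j)).
Proof.
split=> [R q q1|q]; apply: P_closed => // k k0.
  apply/eqP => /(congr1 (fun z => `|z|)); rewrite normrX normr1 => /eqP.
  by rewrite lt_eqF // exprn_ilt1 // -lt0n.
rewrite -tofracXn -tofrac1 tofrac_eq.
apply/eqP => /(congr1 (fun p => size (p : {poly int}))).
by rewrite size_polyXn size_poly1; case: k k0.
Qed.
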